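(* Let $I\subset\mathbb R$ be an interval, $\gamma:I\to\mathbb C$ an immersed $C^2$ curve, $m>0$, and let $T$ be the twizzler $\langle\gamma,m\rangle$ in $\mathbb R^3$, i.e. the surface parameterized by $T(u,v)=e^{iv}\gamma(u)+mv\,\mathbf e_3$, $(u,v)\in I\times\mathbb R$. Then $T$ has constant mean curvature if and only if there are real constants $H$ and $C$ such that, at every $u\in I$, $$C=\frac{2\pi}{\sqrt g}\,m\,\gamma'\cdot i\gamma-H\pi|\gamma|^2,$$ where $\sqrt g=\sqrt{(T_u\cdot T_u)(T_v\cdot T_v)-(T_u\cdot T_v)^2}$ is the area density of $T$. Further, if $T$ is not a cylinder, then $H$ is the mean curvature of $T$.
   Context: $\mathrm{span}(\mathbf e_1,\mathbf e_2)\subset\mathbb R^3$ is identified with $\mathbb C$ via $a\mathbf e_1+b\mathbf e_2\leftrightarrow a+ib$, and $\cdot$ is the Euclidean inner product (so $\gamma'\cdot i\gamma$ is the real inner product of the plane vectors $\gamma'$ and $i\gamma$). $T$ is automatically immersed and $g$ depends only on $u$. Mean curvature is the trace (not the average) of the second fundamental form, with sign given by $h=\mathrm{div}(\boldsymbol\nu)=\mathrm D_{\mathbf f_1}\boldsymbol\nu\cdot\mathbf f_1+\mathrm D_{\mathbf f_2}\boldsymbol\nu\cdot\mathbf f_2$ for a local orthonormal tangent frame $(\mathbf f_1,\mathbf f_2)$, where $\boldsymbol\nu=T_u\times T_v/\sqrt g$. ''$T$ is a cylinder'' means that $|\gamma|$ is constant on $I$, i.e. $T$ lies on a circular cylinder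 about the $\mathbf e_3$-axis. *)

(* Defs.v *)
From Stdlib Require Export Reals ClassicalEpsilon.
From Coquelicot Require Export Coquelicot.
Open Scope R_scope.

Definition is_interval (I : R -> Prop) : Prop :=
  forall a b x, I a -> I b -> a <= x <= b -> I x.

Definition nondegenerate (I : R -> Prop) : Prop :=
  exists a b, I a /\ I b /\ a < b.

(* [is_derive] with the neighbourhood filter restricted to [D], so that at an
   endpoint of an interval this is the one-sided derivative. *)
Definition is_derive_on {V : NormedModule R_AbsRing}
    (D : R -> Prop) (f : R -> V) (x : R) (l : V) : Prop :=
  filterdiff f (within D (locally x)) (fun y => scal y l).

Definition ex_derive_on {V : NormedModule R_AbsRing}
    (D : R -> Prop) (f : R -> V) (x : R) : Prop :=
  exists l, is_derive_on D f x l.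

(* Total operator; meaningful only where [ex_derive_on] holds. *)
Definition Derive_on {V : NormedModule R_AbsRing}
    (D : R -> Prop) (f : R -> V) (x : R) : V :=
  epsilon (inhabits zero) (is_derive_on D f x).

Definition C2_on {V : NormedModule R_AbsRing}
    (D : R -> Prop) (f : R -> V) : Prop :=
  (forall x, D x -> ex_derive_on D f x) /\
  (forall x, D x -> ex_derive_on D (Derive_on D f) x) /\
  continuous_on D (Derive_on D (Derive_on D f)).

Definition immersed_on {V : NormedModule R_AbsRing}
    (D : R -> Prop) (f : R -> V) : Prop :=
  forall x, D x -> Derive_on D f x <> zero.

Definition R3 : Type := (R * R * R)%type.

Definition c1 (x : R3) : R := fst (fst x).
Definition c2 (x : R3) : R := snd (fst x).
Definition c3 (x : R3) : R := snd x.

Definition e3 : R3 := (0, 0, 1).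

Definition dot (x y : R3) : R := c1 x * c1 y + c2 x * c2 y + c3 x * c3 y.

Definition cross (x y : R3) : R3 :=
  (c2 x * c3 y - c3 x * c2 y,
   c3 x * c1 y - c1 x * c3 y,
   c1 x * c2 y - c2 x * c1 y).

Definition plane (z : C) : R3 := (Re z, Im z, 0).

(* Below, [X u v], for [(u, v)] in [D] x R, parameterizes a surface. *)

Definition partial_u (D : R -> Prop) (Y : R -> R -> R3) (u v : R) : R3 :=
  Derive_on D (fun s => Y s v) u.
Definition partial_v (Y : R -> R -> R3) (u v : R) : R3 :=
  Derive_on (fun _ => True) (fun t => Y u t) v.

Definition area_density (D : R -> Prop) (X : R -> R -> R3)
    (u v : R) : R :=
  sqrt (dot (partial_u D X u v) (partial_u D X u v)
        * dot (partial_v X u v) (partial_v X u v)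
        - dot (partial_u D X u v) (partial_v X u v) ^ 2).

Definition unit_normal (D : R -> Prop) (X : R -> R -> R3)
    (u v : R) : R3 :=
  scal (/ area_density D X u v) (cross (partial_u D X u v) (partial_v X u v)).

Definition tangent (D : R -> Prop) (X : R -> R -> R3)
    (u v a b : R) : R3 :=
  plus (scal a (partial_u D X u v)) (scal b (partial_v X u v)).

(* Directional derivative of the normal along [tangent D X u v a b]. *)
Definition D_normal (D : R -> Prop) (X : R -> R -> R3)
    (u v a b : R) : R3 :=
  plus (scal a (partial_u D (unit_normal D X) u v))
       (scal b (partial_v (unit_normal D X) u v)).

Definition orthonormal (f g : R3) : Prop :=
  dot f f = 1 /\ dot g g = 1 /\ dot f g = 0.

(* [h] is the divergence of the unit normal, computed in an orthonormal
   tangent frame; its value does not depend on the frame chosen. *)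
Definition is_mean_curvature (D : R -> Prop) (X : R -> R -> R3)
    (u v h : R) : Prop :=
  exists a1 b1 a2 b2 : R,
    orthonormal (tangent D X u v a1 b1) (tangent D X u v a2 b2) /\
    h = dot (D_normal D X u v a1 b1) (tangent D X u v a1 b1)
        + dot (D_normal D X u v a2 b2) (tangent D X u v a2 b2).

Definition has_constant_mean_curvature
    (D : R -> Prop) (X : R -> R -> R3) (h : R) : Prop :=
  forall u v, D u -> is_mean_curvature D X u v h.

Definition Cexp_i (v : R) : C := (cos v, sin v).

Definition twizzler (gamma : R -> C) (m : R) (u v : R) : R3 :=
  plus (plane (Cmult (Cexp_i v) (gamma u))) (scal (m * v) e3).

(* The twizzler lies on a circular cylinder about the e3-axis. *)
Definition is_cylinder (D : R -> Prop) (gamma : R -> C) : Prop :=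
  exists r, forall u, D u -> Cmod (gamma u) = r.

Definition conservation_law
    (D : R -> Prop) (gamma : R -> C) (m H c : R) : Prop :=
  forall u v, D u ->
    c = 2 * PI / area_density D (twizzler gamma m) u v
          * m * dot (plane (Derive_on D gamma u)) (plane (Cmult Ci (gamma u)))
        - H * PI * Cmod (gamma u) ^ 2.

(* Main.v *)
Require Import Defs.
From Stdlib Require Import Classical Lra Psatz.

(* Write h for the mean curvature, which by helicoidal symmetry depends only on
   u, and put flux = m (gamma' . i gamma) / sqrt g. A computation gives
   flux' = h (gamma . gamma'), so that
     (2 pi flux - H pi |gamma|^2)' = 2 pi (h - H) (gamma . gamma'),
   and the conservation law with constant H amounts to
   (h - H) (gamma . gamma') = 0. Near a point where h <> H, gamma . gamma'
   vanishes identically, so |gamma| and flux are constant there; differentiating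
   gamma . gamma' = 0 once more yields h = flux / |gamma|^2, which is then also
   constant. As h is continuous, {h = h(u0)} is open and closed in I whenever
   h(u0) <> H. Hence either h = H on all of I, or T is a cylinder and h is
   constant. *)

(** * Derivatives relative to a subset of the line: transfer, uniqueness, constancy *)

Lemma within_le (D : R -> Prop) (x : R) :
  filter_le (within D (locally x)) (locally x).
Proof.
  intros P HP. unfold within. now apply filter_imp with (2 := HP).
Qed.

(** [filterdiff] quantifies over all limits of its filter, so this reduces every such condition to
    the point [x]. Since [x] lies in [D], a property holding on [D] near [x] holds at [x]; applied
    to the property of being a neighbourhood of a point, this makes every neighbourhood of [z] one
    of [x]. *)
Lemma within_filter_lim (D : R -> Prop) (x z : R) :
  D x -> is_filter_lim (within D (locally x)) z -> z = x.
Proof.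
  intros Dx Hz. symmetry. apply (is_filter_lim_locally_unique (V := R_NormedModule)).
  intros P HP.
  apply (locally_locally (T := R_UniformSpace)) in HP.
  pose proof (Hz _ HP) as H. unfold within in H.
  now apply locally_singleton in H; auto.
Qed.

Lemma within_proper (D : R -> Prop) (x : R) :
  D x -> ProperFilter (within D (locally x)).
Proof.
  intros Dx. split.
  - intros P HP. exists x. unfold within in HP. apply locally_singleton in HP. auto.
  - apply within_filter, locally_filter.
Qed.

Lemma within_is_filter_lim (D : R -> Prop) (x : R) :
  is_filter_lim (within D (locally x)) x.
Proof. intros P HP. now apply within_le. Qed.

Lemma is_derive_on_ext {V : NormedModule R_AbsRing} (D : R -> Prop)
    (f g : R -> V) (x : R) (l : V) :
  (forall y, D y -> f y = g y) -> D x ->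
  is_derive_on D f x l -> is_derive_on D g x l.
Proof.
  intros Hfg Dx. apply filterdiff_ext_loc.
  - unfold within. apply (filter_forall (F := locally x)). exact Hfg.
  - intros z Hz. apply within_filter_lim in Hz as ->; auto.
Qed.

Lemma is_derive_is_derive_on {V : NormedModule R_AbsRing} (D : R -> Prop)
    (f : R -> V) (x : R) (l : V) :
  D x -> is_derive f x l -> is_derive_on D f x l.
Proof.
  intros Dx.
  exact (filterdiff_locally (U := R_NormedModule) (FF := within_proper D x Dx)
           f x _ (within_is_filter_lim D x)).
Qed.

(** Off [D] the function is continued by its tangent line at [x], where the first-order error is
    zero. This reduces relative derivatives to ordinary ones, endpoints included. *)
Lemma is_derive_on_extension {V : NormedModule R_AbsRing} (D : R -> Prop)
    (f : R -> V) (x : R) (l : V) :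
  D x -> is_derive_on D f x l ->
  exists fe : R -> V, is_derive fe x l /\ (forall y, D y -> fe y = f y).
Proof.
  intros Dx [Hlin Hdom].
  exists (fun y => if excluded_middle_informative (D y) then f y
                   else plus (f x) (scal (minus y x) l)).
  split.
  - split; [exact Hlin|]. intros z Hz.
    apply (is_filter_lim_locally_unique (V := R_NormedModule)) in Hz as <-.
    specialize (Hdom x (within_is_filter_lim D x)). intros eps.
    specialize (Hdom eps). unfold within in Hdom.
    revert Hdom. apply filter_imp. intros y Hy.
    destruct (excluded_middle_informative (D x)) as [_|n]; [|easy].
    destruct (excluded_middle_informative (D y)) as [d|n]; [auto|].
    replace (minus (plus (f x) (scal (minus y x) l)) (f x)) with (scal (minus y x) l).
    + rewrite (minus_eq_zero (G := V)).
      apply Rle_trans with 0; [apply Req_le, (norm_zero (V := V))|].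
      apply Rmult_le_pos; [apply Rlt_le, cond_pos|apply norm_ge_0].
    + generalize (scal (minus y x) l); intros s. unfold minus.
      now rewrite (plus_comm (G := V) (f x)), <- (plus_assoc (G := V)),
        (plus_opp_r (G := V)), (plus_zero_r (G := V)).
  - intros y Dy. destruct (excluded_middle_informative (D y)); easy.
Qed.

Lemma is_derive_on_pair {V W : NormedModule R_AbsRing} (D : R -> Prop)
    (f : R -> V) (g : R -> W) (x : R) (lf : V) (lg : W) :
  is_derive_on D f x lf -> is_derive_on D g x lg ->
  is_derive_on (V := prod_NormedModule R_AbsRing V W) D (fun y => (f y, g y)) x (lf, lg).
Proof.
  intros Hf Hg.
  apply (filterdiff_comp_2 (F := within D (locally x)) (U := V) (V := W)
           (W := prod_NormedModule R_AbsRing V W) f g pair _ _ pair Hf Hg).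
  apply filterdiff_linear.
  split.
  - now intros [] [].
  - now intros k [].
  - exists 1. split; [apply Rlt_0_1|]. intros [a b]. rewrite Rmult_1_l. apply Rle_refl.
Qed.

Lemma is_derive_on_fst {V W : NormedModule R_AbsRing} (D : R -> Prop)
    (f : R -> prod_NormedModule R_AbsRing V W) (x : R)
    (l : prod_NormedModule R_AbsRing V W) :
  is_derive_on D f x l -> is_derive_on D (fun y => fst (f y)) x (fst l).
Proof.
  intros Hf.
  apply (filterdiff_comp (F := within D (locally x)) f
     (fst : prod_NormedModule R_AbsRing V W -> V) _ fst Hf).
  apply filterdiff_linear, is_linear_fst.
Qed.

Lemma is_derive_on_snd {V W : NormedModule R_AbsRing} (D : R -> Prop)
    (f : R -> prod_NormedModule R_AbsRing V W) (x : R)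
    (l : prod_NormedModule R_AbsRing V W) :
  is_derive_on D f x l -> is_derive_on D (fun y => snd (f y)) x (snd l).
Proof.
  intros Hf.
  apply (filterdiff_comp (F := within D (locally x)) f
     (snd : prod_NormedModule R_AbsRing V W -> W) _ snd Hf).
  apply filterdiff_linear, is_linear_snd.
Qed.

Definition is_limit_point (D : R -> Prop) (x : R) : Prop :=
  forall eps : posreal, exists y, D y /\ y <> x /\ ball x eps y.

(** A short step towards [b] stays in [D] when [x < b]; otherwise [a < x], and a short step towards
    [a] does. *)
Lemma nondegenerate_limit_point (D : R -> Prop) (x : R) :
  is_interval D -> nondegenerate D -> D x -> is_limit_point D x.
Proof.
  intros HI (a & b & Da & Db & ab) Dx [eps He].
  destruct (Rlt_dec x b) as [xb|xb].
  - exists (x + Rmin (eps / 2) (b - x)).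
    assert (0 < Rmin (eps / 2) (b - x)) by (apply Rmin_glb_lt; lra).
    pose proof (Rmin_l (eps / 2) (b - x)). pose proof (Rmin_r (eps / 2) (b - x)).
    split; [apply (HI x b); auto; lra|]. split; [lra|].
    change (Rabs (x + Rmin (eps / 2) (b - x) - x) < eps).
    rewrite Rabs_pos_eq; lra.
  - exists (x - Rmin (eps / 2) (x - a)).
    assert (0 < Rmin (eps / 2) (x - a)) by (apply Rmin_glb_lt; lra).
    pose proof (Rmin_l (eps / 2) (x - a)). pose proof (Rmin_r (eps / 2) (x - a)).
    split; [apply (HI a x); auto; lra|]. split; [lra|].
    change (Rabs (x - Rmin (eps / 2) (x - a) - x) < eps).
    rewrite Rabs_left; lra.
Qed.

(** The difference of the first-order remainders belonging to two candidate derivatives [l1] and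
    [l2], where [k] is the increment of the variable. *)
Lemma minus_scal_cancel {K : AbsRing} {V : NormedModule K} (w l1 l2 : V) (k : K) :
  plus (minus w (scal k l2)) (scal (opp one) (minus w (scal k l1)))
  = scal k (minus l1 l2).
Proof.
  rewrite scal_opp_one. unfold minus.
  rewrite (@scal_distr_l K V), (@scal_opp_r K V), (opp_plus (G := V)), (opp_opp (G := V)),
    (plus_comm (G := V) w), <- (plus_assoc (G := V)), (plus_assoc (G := V) w),
    (plus_opp_r (G := V)), (plus_zero_l (G := V)).
  apply plus_comm.
Qed.

(** The two remainders differ by [(y - x)] times [l1 - l2], and this is [o(y - x)]. A point [y] of
    [D] close to [x] but distinct from it allows division by [y - x]. *)
Lemma is_derive_on_unique {V : NormedModule R_AbsRing} (D : R -> Prop)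
    (f : R -> V) (x : R) (l1 l2 : V) :
  is_limit_point D x -> is_derive_on D f x l1 -> is_derive_on D f x l2 -> l1 = l2.
Proof.
  intros acc [_ H1] [_ H2].
  specialize (H1 x (within_is_filter_lim D x)). specialize (H2 x (within_is_filter_lim D x)).
  assert (FF : Filter (within D (locally x))) by apply within_filter, locally_filter.
  assert (Hd := domin_plus _ _ _ H2 (domin_scal_r _ _ (opp one) H1)).
  assert (Hsmall : forall eps : posreal, norm (minus l1 l2) <= eps).
  { intros eps. destruct (Hd eps) as [d Hd'].
    destruct (acc d) as (y & Dy & yx & By).
    specialize (Hd' y By Dy). cbv beta in Hd'.
    assert (E : minus l1 l2 = scal (/ (y - x)) (scal (minus y x) (minus l1 l2))).
    { rewrite scal_assoc.
      replace (mult (/ (y - x)) (minus y x)) with (one : R_AbsRing).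
      - now rewrite scal_one.
      - unfold mult, minus, plus, opp, one; simpl. field. lra. }
    match type of Hd' with norm ?a <= _ =>
      replace a with (scal (minus y x) (minus l1 l2)) in Hd' end.
    - rewrite E.
      apply Rle_trans with
        (1 := @norm_scal R_AbsRing V (/ (y - x)) (scal (minus y x) (minus l1 l2))).
      apply Rle_trans with (Rabs (/ (y - x)) * (eps * Rabs (y - x))).
      + apply Rmult_le_compat_l; [apply Rabs_pos|exact Hd'].
      + rewrite Rabs_inv. right. field. apply Rabs_no_R0. lra.
    - symmetry. exact (minus_scal_cancel (K := R_AbsRing) (minus (f y) (f x)) l1 l2 (minus y x)). }
  assert (Hn : norm (minus l1 l2) = 0).
  { apply Rle_antisym; [|apply norm_ge_0]. apply Rnot_lt_le. intros Hp.
    specialize (Hsmall (mkposreal _ (Rdiv_lt_0_compat _ 2 Hp ltac:(lra)))). simpl in Hsmall.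
    lra. }
  apply norm_eq_zero in Hn.
  rewrite <- (plus_zero_l (G := V) l2), <- Hn. unfold minus.
  now rewrite <- (plus_assoc (G := V)), (plus_opp_l (G := V)), (plus_zero_r (G := V)).
Qed.

Lemma Derive_on_unique {V : NormedModule R_AbsRing} (D : R -> Prop)
    (f : R -> V) (x : R) (l : V) :
  is_limit_point D x -> is_derive_on D f x l -> Derive_on D f x = l.
Proof.
  intros acc H. apply (is_derive_on_unique D f x); auto.
  exact (epsilon_spec _ (is_derive_on D f x) (ex_intro _ l H)).
Qed.

Lemma Derive_on_correct {V : NormedModule R_AbsRing} (D : R -> Prop)
    (f : R -> V) (x : R) :
  ex_derive_on D f x -> is_derive_on D f x (Derive_on D f x).
Proof. exact (epsilon_spec _ (is_derive_on D f x)). Qed.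

(** The mean value theorem on [[a, b]]. Later it also serves as a connectedness principle: a locally
    constant function on an interval is constant. *)
Lemma is_derive_on_zero_const (D : R -> Prop) (f : R -> R) :
  is_interval D -> (forall x, D x -> is_derive_on D f x 0) ->
  forall a b, D a -> D b -> f a = f b.
Proof.
  intros HI Hd.
  enough (H : forall a b, D a -> D b -> a <= b -> f a = f b).
  { intros a b Da Db. destruct (Rle_dec a b); [auto|]. symmetry. apply H; auto; lra. }
  intros a b Da Db ab.
  (* The retraction of the line onto [[a, b]]: composed with it, [f] becomes continuous in the
     two-sided sense even at [a] and [b], as [MVT_gen] demands. *)
  set (clamp := fun x => Rmax a (Rmin b x)).
  assert (clampD : forall x, D (clamp x)).
  { intros x. apply (HI a b); auto. unfold clamp. split; [apply Rmax_l|].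
    apply Rmax_lub; [lra|apply Rmin_l]. }
  assert (clamp_id : forall x, a <= x <= b -> clamp x = x).
  { intros x Hx. unfold clamp. rewrite Rmin_right, Rmax_right; lra. }
  destruct (MVT_gen (fun x => f (clamp x)) a b (fun _ => 0)) as (c & _ & Hc).
  - intros x. rewrite Rmin_left, Rmax_right by lra. intros Hx.
    destruct (is_derive_on_extension D f x 0) as (fe & Hfe & E).
    + apply (HI a b); auto; lra.
    + apply Hd. apply (HI a b); auto; lra.
    + apply is_derive_ext_loc with (2 := Hfe).
      apply filter_imp with (fun y => a < y < b).
      * intros y Hy. rewrite clamp_id by lra. apply E. apply (HI a b); auto; lra.
      * apply (open_and (fun y => a < y) (fun y => y < b)); [apply open_gt|apply open_lt|exact Hx].
  - intros x _. apply continuity_pt_filterlim.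
    apply (filterlim_comp _ _ _ clamp f _ (within D (locally (clamp x)))).
    + intros P HP. unfold filtermap.
      assert (Hcl : continuous clamp x).
      { apply continuity_pt_filterlim. unfold clamp.
        (* Maximum and minimum are expressed through absolute values, whose continuity is known. *)
        apply (continuity_pt_ext (fun x =>
          (a + ((b + x - Rabs (b - x)) / 2) + Rabs (a - ((b + x - Rabs (b - x)) / 2))) / 2)).
        - intros t. unfold Rmax, Rmin. unfold Rabs.
          repeat destruct Rle_dec; repeat destruct Rcase_abs; lra.
        - reg; apply Rcontinuity_abs. }
      specialize (Hcl _ HP). unfold filtermap in Hcl.
      revert Hcl. apply filter_imp. intros y Hy. apply Hy, clampD.
    + assert (FF : Filter (within D (locally (clamp x)))) by apply within_filter, locally_filter.
      apply (filterdiff_continuous_aux (U := R_NormedModule) (V := R_NormedModule) f).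
      * eexists. apply Hd, clampD.
      * apply within_is_filter_lim.
  - rewrite Rmult_0_l in Hc. rewrite !clamp_id in Hc by lra. lra.
Qed.

(** * Computation rules for relative derivatives *)

Lemma triple_eq (a b c a' b' c' : R) :
  a = a' -> b = b' -> c = c' -> (a, b, c) = (a', b', c').
Proof. now intros -> -> ->. Qed.

Lemma is_derive_on_triple (D : R -> Prop) (f1 f2 f3 : R -> R) (x l1 l2 l3 : R) :
  is_derive_on D f1 x l1 -> is_derive_on D f2 x l2 -> is_derive_on D f3 x l3 ->
  is_derive_on (V := prod_NormedModule R_AbsRing
                       (prod_NormedModule R_AbsRing R_NormedModule R_NormedModule)
                       R_NormedModule)
    D (fun y => (f1 y, f2 y, f3 y)) x (l1, l2, l3).
Proof.
  intros H1 H2 H3. apply (is_derive_on_pair D (fun y => (f1 y, f2 y)) f3); auto.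
  now apply is_derive_on_pair.
Qed.

Lemma limit_point_full (x : R) : is_limit_point (fun _ => True) x.
Proof.
  apply nondegenerate_limit_point; auto.
  - now intros a b y _ _ _.
  - exists 0, 1. repeat split; lra.
Qed.

Lemma is_derive_on_locally_const (D : R -> Prop) (f : R -> R) (x : R) :
  D x -> within D (locally x) (fun y => f y = f x) -> is_derive_on D f x 0.
Proof.
  intros Dx Hf.
  apply (filterdiff_ext_loc (U := R_NormedModule) (fun _ => f x)).
  - revert Hf. apply filter_imp. now intros y Hy.
  - intros z Hz. now apply within_filter_lim in Hz as ->.
  - apply (is_derive_is_derive_on D (fun _ => f x)); auto.
    apply (is_derive_const (V := R_NormedModule) (f x)).
Qed.

Lemma is_derive_on_subset {V : NormedModule R_AbsRing} (D E : R -> Prop)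
    (f : R -> V) (x : R) (l : V) :
  (forall y, E y -> D y) -> E x -> is_derive_on D f x l -> is_derive_on E f x l.
Proof.
  intros ED Ex [Hl Hd]. split; [exact Hl|]. intros z Hz.
  apply within_filter_lim in Hz as ->; auto.
  apply (is_domin_le (F := within D (locally x))).
  - apply Hd, within_is_filter_lim.
  - intros Q. unfold within. apply filter_imp. auto.
Qed.

(** Trades a relative derivative for an ordinary one of a function agreeing on the domain, so that
    [auto_derive] applies; [Dfe] then evaluates the [Derive] terms it produces. *)
Ltac extend H :=
  let fe := fresh "fe" in let Hfe := fresh "Hfe" in let Ee := fresh "Ee" in
  let Dfe := fresh "Dfe" in
  apply is_derive_on_extension in H as (fe & Hfe & Ee); [|assumption];
  pose proof (is_derive_unique (fun s : R => fe s : R) _ _ Hfe) as Dfe.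

Lemma is_derive_on_combination (D : R -> Prop) (f g : R -> R) (a b x lf lg : R) :
  D x -> is_derive_on D f x lf -> is_derive_on D g x lg ->
  is_derive_on D (fun s => a * f s + b * g s) x (a * lf + b * lg).
Proof.
  intros Dx Hf Hg. extend Hf. extend Hg.
  apply (is_derive_on_ext D (fun s => a * fe s + b * fe0 s)); auto.
  { intros s Ds. now rewrite Ee, Ee0. }
  apply is_derive_is_derive_on; auto.
  auto_derive.
  - split; [now exists lf|]. split; [now exists lg|easy].
  - rewrite Dfe, Dfe0. ring.
Qed.

Lemma is_derive_on_mult (D : R -> Prop) (f g : R -> R) (x lf lg : R) :
  D x -> is_derive_on D f x lf -> is_derive_on D g x lg ->
  is_derive_on D (fun s => f s * g s) x (lf * g x + f x * lg).
Proof.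
  intros Dx Hf Hg. extend Hf. extend Hg.
  apply (is_derive_on_ext D (fun s => fe s * fe0 s)); auto.
  { intros s Ds. now rewrite Ee, Ee0. }
  apply is_derive_is_derive_on; auto.
  rewrite <- Ee, <- Ee0 by assumption.
  auto_derive.
  - split; [now exists lf|]. split; [now exists lg|easy].
  - rewrite Dfe, Dfe0. ring.
Qed.

Lemma is_derive_on_inv_sqrt (D : R -> Prop) (f : R -> R) (x lf : R) :
  D x -> 0 < f x -> is_derive_on D f x lf ->
  is_derive_on D (fun s => / sqrt (f s)) x (- lf / (2 * sqrt (f x) ^ 3)).
Proof.
  intros Dx Pf Hf. extend Hf.
  apply (is_derive_on_ext D (fun s => / sqrt (fe s))); auto.
  { intros s Ds. now rewrite Ee. }
  apply is_derive_is_derive_on; auto.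
  rewrite <- Ee in * by assumption.
  pose proof (sqrt_lt_R0 _ Pf) as Ps.
  auto_derive.
  - split; [now exists lf|]. repeat split; try easy. lra.
  - rewrite Dfe. field. lra.
Qed.

(** * Algebra of tangent frames and of radially critical points *)

(* Row orthonormality [M g M^T = 1] of the coefficient matrix [M] gives
   [M^T M = g^-1], so the trace does not depend on the frame. *)
Lemma frame_trace (a1 b1 a2 b2 E F G p q r s : R) :
  0 < E * G - F ^ 2 ->
  a1 ^ 2 * E + 2 * a1 * b1 * F + b1 ^ 2 * G = 1 ->
  a2 ^ 2 * E + 2 * a2 * b2 * F + b2 ^ 2 * G = 1 ->
  a1 * a2 * E + (a1 * b2 + b1 * a2) * F + b1 * b2 * G = 0 ->
  (a1 ^ 2 + a2 ^ 2) * p + (a1 * b1 + a2 * b2) * (q + r) + (b1 ^ 2 + b2 ^ 2) * s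
  = (G * p - F * (q + r) + E * s) / (E * G - F ^ 2).
Proof.
  intros Hg H1 H2 H3. set (g := E * G - F ^ 2) in *.
  set (d := a1 * b2 - b1 * a2).
  (* [d] is the determinant of [M]; this is the determinant of the orthonormality relation. *)
  assert (Hd : d ^ 2 * g = 1).
  { unfold d, g.
    replace ((a1 * b2 - b1 * a2) ^ 2 * (E * G - F ^ 2)) with
      ((a1 ^ 2 * E + 2 * a1 * b1 * F + b1 ^ 2 * G)
       * (a2 ^ 2 * E + 2 * a2 * b2 * F + b2 ^ 2 * G)
       - (a1 * a2 * E + (a1 * b2 + b1 * a2) * F + b1 * b2 * G) ^ 2) by ring.
    rewrite H1, H2, H3. ring. }
  (* [K1], [K2], [K3] are the entries of the inverse metric, with [d ^ 2] in place of [/ g]. The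
     factors 1 and 0 are inserted so that the orthonormality relations can be substituted for
     them. *)
  assert (K1 : a1 ^ 2 + a2 ^ 2 = d ^ 2 * G).
  { unfold d.
    replace (a1 ^ 2 + a2 ^ 2) with (a1 ^ 2 * 1 + a2 ^ 2 * 1 - 2 * a1 * a2 * 0) by ring.
    rewrite <- H2 at 1. rewrite <- H1 at 1. rewrite <- H3. ring. }
  assert (K2 : a1 * b1 + a2 * b2 = - (d ^ 2 * F)).
  { unfold d.
    replace (a1 * b1 + a2 * b2) with
      (a1 * b1 * 1 + a2 * b2 * 1 - (a1 * b2 + a2 * b1) * 0) by ring.
    rewrite <- H2 at 1. rewrite <- H1 at 1. rewrite <- H3. ring. }
  assert (K3 : b1 ^ 2 + b2 ^ 2 = d ^ 2 * E).
  { unfold d.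
    replace (b1 ^ 2 + b2 ^ 2) with (b1 ^ 2 * 1 + b2 ^ 2 * 1 - 2 * b1 * b2 * 0) by ring.
    rewrite <- H2 at 1. rewrite <- H1 at 1. rewrite <- H3. ring. }
  rewrite K1, K2, K3.
  apply (Rmult_eq_reg_r g); [|lra].
  replace ((G * p - F * (q + r) + E * s) / g * g) with
    ((G * p - F * (q + r) + E * s) * 1) by (field; lra).
  rewrite <- Hd. ring.
Qed.

Lemma dot_combination (a b c d : R) (x y z t : R3) :
  dot (plus (scal a x) (scal b y)) (plus (scal c z) (scal d t)) =
  a * c * dot x z + a * d * dot x t + b * c * dot y z + b * d * dot y t.
Proof.
  destruct x as [[x1 x2] x3], y as [[y1 y2] y3], z as [[z1 z2] z3], t as [[t1 t2] t3].
  transitivity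
    ((a * x1 + b * y1) * (c * z1 + d * t1) + (a * x2 + b * y2) * (c * z2 + d * t2)
     + (a * x3 + b * y3) * (c * z3 + d * t3)); [reflexivity|].
  unfold dot, c1, c2, c3. cbn [fst snd]. ring.
Qed.

(** Gram-Schmidt: the first basis vector is normalised by [e], and the part of the second orthogonal
    to it has length [r / e]. *)
Lemma orthonormal_frame_exists (E F G : R) :
  0 < E -> 0 < E * G - F ^ 2 ->
  exists a1 b1 a2 b2,
  a1 ^ 2 * E + 2 * a1 * b1 * F + b1 ^ 2 * G = 1 /\
  a2 ^ 2 * E + 2 * a2 * b2 * F + b2 ^ 2 * G = 1 /\
  a1 * a2 * E + (a1 * b2 + b1 * a2) * F + b1 * b2 * G = 0.
Proof.
  intros HE Hg.
  set (e := sqrt E). set (r := sqrt (E * G - F ^ 2)).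
  assert (e2 : e * e = E) by (apply sqrt_sqrt; lra).
  assert (r2 : r * r = E * G - F ^ 2) by (apply sqrt_sqrt; lra).
  assert (0 < e) by now apply sqrt_lt_R0.
  assert (0 < r) by now apply sqrt_lt_R0.
  exists (/ e), 0, (- F / (e * r)), (e / r).
  assert (K : E * G - F ^ 2 <> 0) by lra.
  split; [|split].
  - rewrite <- e2. field. lra.
  - replace ((- F / (e * r)) ^ 2 * E + 2 * (- F / (e * r)) * (e / r) * F + (e / r) ^ 2 * G)
      with ((F ^ 2 * (E / (e * e)) - 2 * F ^ 2 + (e * e) * G) / (r * r)) by (field; lra).
    rewrite e2, r2. field. repeat split; lra.
  - rewrite <- e2. field. lra.
Qed.

(* [|z|^2 (z' x z'') = (z . z') (z x z'') - (z x z') (z . z'')], where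
   [z . z' = 0] and [z . z'' = - |z'|^2]. *)
Lemma radial_critical_identity (m x y p q a b r : R) :
  0 < r -> r * r = m ^ 2 * (p ^ 2 + q ^ 2) -> p * x + q * y = 0 ->
  a * x + p ^ 2 + b * y + q ^ 2 = 0 ->
  x ^ 2 + y ^ 2 <> 0 /\
  m * ((x ^ 2 + y ^ 2 + m ^ 2) * (p * b - q * a) - (q * x - p * y) * (p ^ 2 + q ^ 2)) / r ^ 3
  = m * ((q * x - p * y) * / r) / (x ^ 2 + y ^ 2).
Proof.
  intros Hs Ha HP HdP.
  (* At [z = 0] the relation [z . z'' = - |z'|^2] would force [z' = 0], hence [r = 0]. *)
  assert (A0 : x ^ 2 + y ^ 2 <> 0).
  { intros A0. assert (x = 0) by nra. assert (y = 0) by nra. subst x y.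
    replace (p ^ 2 + q ^ 2) with 0 in Ha by lra. nra. }
  split; [exact A0|].
  assert (K : (x ^ 2 + y ^ 2) * (p * b - q * a) = (q * x - p * y) * (p ^ 2 + q ^ 2)).
  { replace ((x ^ 2 + y ^ 2) * (p * b - q * a)) with
      ((p * x + q * y) * (x * b - y * a) - (q * x - p * y) * (a * x + b * y)) by ring.
    rewrite HP. replace (a * x + b * y) with (- (p ^ 2 + q ^ 2)) by lra. ring. }
  apply (Rmult_eq_reg_r (r ^ 3 * (x ^ 2 + y ^ 2))).
  2: { apply Rmult_integral_contrapositive. split; [apply pow_nonzero; lra|exact A0]. }
  (* The common value of both sides once denominators are cleared: the left reaches it by [K], the
     right by the formula for [r * r]. *)
  transitivity (m * (m ^ 2 * (p ^ 2 + q ^ 2)) * (q * x - p * y)).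
  - transitivity (m * ((x ^ 2 + y ^ 2 + m ^ 2) * ((x ^ 2 + y ^ 2) * (p * b - q * a))
      - (x ^ 2 + y ^ 2) * ((q * x - p * y) * (p ^ 2 + q ^ 2)))); [field; lra|].
    rewrite K. ring.
  - rewrite <- Ha. field. split; [lra|exact A0].
Qed.

(** * First fundamental form and unit normal of the twizzler in closed form *)

Definition area2 (m : R) (z dz : C) : R :=
  m ^ 2 * (Re dz ^ 2 + Im dz ^ 2) + (Re dz * Re z + Im dz * Im z) ^ 2.

(** The inner product of [dz] with [i z], which is also the metric coefficient [F]. *)
Definition twist (z dz : C) : R := Im dz * Re z - Re dz * Im z.

(** The classical quotient [(G L - 2 F M + E N) / (E G - F^2)], simplified using that [M] and [N]
    are [m |dz|^2] and [m F] divided by the area density. *)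
Definition mean_curvature (m : R) (z dz ddz : C) : R :=
  m * ((Re z ^ 2 + Im z ^ 2 + m ^ 2) * (Re dz * Im ddz - Im dz * Re ddz)
       - twist z dz * (Re dz ^ 2 + Im dz ^ 2)) / sqrt (area2 m z dz) ^ 3.

(** The summand [m ^ 2 |dz|^2] is already positive. Lagrange's identity turns [E G - F^2] into this
    sum, in which positivity is visible. *)
Lemma area2_pos (m : R) (z dz : C) : 0 < m -> dz <> zero -> 0 < area2 m z dz.
Proof.
  intros Hm Hz. unfold area2. destruct dz as [p q]. unfold Re, Im, fst, snd.
  assert (p <> 0 \/ q <> 0).
  { destruct (Req_dec p 0) as [->|]; [|auto]. destruct (Req_dec q 0) as [->|]; [|auto].
    now elim Hz. }
  assert (0 < p * p + q * q) by (destruct H; nra).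
  assert (0 < (m * m) * (p * p + q * q)) by (apply Rmult_lt_0_compat; nra).
  destruct z as [x y]. pose proof (pow2_ge_0 (p * x + q * y)).
  replace (m ^ 2 * (p ^ 2 + q ^ 2)) with (m * m * (p * p + q * q)) by ring. lra.
Qed.

Lemma twizzler_coords (gamma : R -> C) (m u v : R) :
  twizzler gamma m u v =
  (cos v * Re (gamma u) - sin v * Im (gamma u),
   sin v * Re (gamma u) + cos v * Im (gamma u), m * v).
Proof.
  transitivity (cos v * Re (gamma u) - sin v * Im (gamma u) + m * v * 0,
    cos v * Im (gamma u) + sin v * Re (gamma u) + m * v * 0, 0 + m * v * 1).
  - reflexivity.
  - apply triple_eq; ring.
Qed.

Lemma twizzler_partial_u (I : R -> Prop) (gamma : R -> C) (m u v : R) :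
  is_limit_point I u -> I u -> ex_derive_on I gamma u ->
  partial_u I (twizzler gamma m) u v =
  (cos v * Re (Derive_on I gamma u) + - sin v * Im (Derive_on I gamma u),
   sin v * Re (Derive_on I gamma u) + cos v * Im (Derive_on I gamma u), 0).
Proof.
  intros acc Iu H. apply Derive_on_correct in H.
  apply Derive_on_unique; auto.
  pose proof (is_derive_on_fst _ _ _ _ H) as H1.
  pose proof (is_derive_on_snd _ _ _ _ H) as H2.
  apply (is_derive_on_ext I (fun s => (cos v * Re (gamma s) + - sin v * Im (gamma s),
     sin v * Re (gamma s) + cos v * Im (gamma s), m * v))); auto.
  - intros s _. rewrite twizzler_coords. apply triple_eq; ring.
  - apply is_derive_on_triple.
    + now apply is_derive_on_combination.
    + now apply is_derive_on_combination.
    + apply is_derive_is_derive_on; auto. apply (is_derive_const (V := R_NormedModule) (m * v)).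
Qed.

Lemma twizzler_partial_v (gamma : R -> C) (m u v : R) :
  partial_v (twizzler gamma m) u v =
  (- sin v * Re (gamma u) - cos v * Im (gamma u),
   cos v * Re (gamma u) - sin v * Im (gamma u), m).
Proof.
  apply Derive_on_unique; [apply limit_point_full|].
  apply (is_derive_on_ext _ (fun t => (cos t * Re (gamma u) + - sin t * Im (gamma u),
     sin t * Re (gamma u) + cos t * Im (gamma u), m * t))); auto.
  - intros s _. rewrite twizzler_coords. apply triple_eq; ring.
  - apply is_derive_on_triple; apply is_derive_is_derive_on; auto; auto_derive; auto; ring.
Qed.

Lemma sin2_cos2_pow (v : R) : sin v ^ 2 = 1 - cos v ^ 2.
Proof. pose proof (sin2_cos2 v) as H. unfold Rsqr in H. lra. Qed.

(** The parameter [v] acts by screw motions, which are isometries, so [v] disappears through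
    [sin2_cos2_pow]. *)
Lemma twizzler_metric (I : R -> Prop) (gamma : R -> C) (m u v : R) :
  is_limit_point I u -> I u -> ex_derive_on I gamma u ->
  let z := gamma u in let dz := Derive_on I gamma u in
  let Tu := partial_u I (twizzler gamma m) u v in
  let Tv := partial_v (twizzler gamma m) u v in
  dot Tu Tu = Re dz ^ 2 + Im dz ^ 2 /\ dot Tu Tv = twist z dz /\
  dot Tv Tv = Re z ^ 2 + Im z ^ 2 + m ^ 2.
Proof.
  intros acc Iu H z dz Tu Tv. unfold Tu, Tv, z, dz.
  rewrite twizzler_partial_u, twizzler_partial_v by assumption.
  unfold dot, c1, c2, c3, twist. cbn [fst snd].
  pose proof (sin2_cos2_pow v) as S.
  repeat split; ring [S].
Qed.

Lemma twizzler_area_density (I : R -> Prop) (gamma : R -> C) (m u v : R) :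
  is_limit_point I u -> I u -> ex_derive_on I gamma u ->
  area_density I (twizzler gamma m) u v = sqrt (area2 m (gamma u) (Derive_on I gamma u)).
Proof.
  intros acc Iu H. unfold area_density.
  destruct (twizzler_metric I gamma m u v acc Iu H) as (-> & -> & ->).
  f_equal. unfold area2, twist. ring.
Qed.

(** The horizontal part is [- i m dz] rotated by [v], the vertical part is [z . dz], and [w]
    normalises. *)
Lemma twizzler_unit_normal (I : R -> Prop) (gamma : R -> C) (m u v : R) :
  is_limit_point I u -> I u -> ex_derive_on I gamma u ->
  let z := gamma u in let dz := Derive_on I gamma u in
  let w := / sqrt (area2 m z dz) in
  unit_normal I (twizzler gamma m) u v =
  (w * (cos v * (m * Im dz) + sin v * (m * Re dz)),
   w * (sin v * (m * Im dz) + - cos v * (m * Re dz)),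
   w * (Re dz * Re z + Im dz * Im z)).
Proof.
  intros acc Iu H z dz w. unfold unit_normal, z, dz, w.
  rewrite twizzler_area_density, twizzler_partial_u, twizzler_partial_v by assumption.
  fold z dz w.
  transitivity
   (w * ((sin v * Re dz + cos v * Im dz) * m - 0 * (cos v * Re z - sin v * Im z)),
    w * (0 * (- sin v * Re z - cos v * Im z) - (cos v * Re dz + - sin v * Im dz) * m),
    w * ((cos v * Re dz + - sin v * Im dz) * (cos v * Re z - sin v * Im z) -
         (sin v * Re dz + cos v * Im dz) * (- sin v * Re z - cos v * Im z)));
    [reflexivity|].
  pose proof (sin2_cos2_pow v) as S.
  apply triple_eq; ring [S].
Qed.

(** * Derivatives of the scalar functions attached to the curve *)

Section Twizzler.
Context (I : R -> Prop) (gamma : R -> C) (m : R).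
Context (I_interval : is_interval I) (I_nondegenerate : nondegenerate I).
Context (gamma_C2 : C2_on I gamma) (gamma_immersed : immersed_on I gamma) (m_pos : 0 < m).

Let dgamma := Derive_on I gamma.
Let ddgamma := Derive_on I (Derive_on I gamma).
Let w u := / sqrt (area2 m (gamma u) (dgamma u)).

Lemma domain_limit_point (u : R) : I u -> is_limit_point I u.
Proof. now apply nondegenerate_limit_point. Qed.

Lemma gamma_derivable (u : R) : I u -> ex_derive_on I gamma u.
Proof. apply gamma_C2. Qed.

Lemma gamma_area2_pos (u : R) : I u -> 0 < area2 m (gamma u) (dgamma u).
Proof. intros Iu. apply area2_pos; [exact m_pos|now apply gamma_immersed]. Qed.

Lemma gamma_derivatives (u : R) : I u ->
  is_derive_on I (fun s => Re (gamma s)) u (Re (dgamma u)) /\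
  is_derive_on I (fun s => Im (gamma s)) u (Im (dgamma u)) /\
  is_derive_on I (fun s => Re (dgamma s)) u (Re (ddgamma u)) /\
  is_derive_on I (fun s => Im (dgamma s)) u (Im (ddgamma u)).
Proof.
  intros Iu. destruct gamma_C2 as (H1 & H2 & _).
  specialize (H1 u Iu). specialize (H2 u Iu).
  apply Derive_on_correct in H1. apply Derive_on_correct in H2.
  split; [|split; [|split]].
  - exact (is_derive_on_fst _ _ _ _ H1).
  - exact (is_derive_on_snd _ _ _ _ H1).
  - exact (is_derive_on_fst _ _ _ _ H2).
  - exact (is_derive_on_snd _ _ _ _ H2).
Qed.

Lemma area2_derivative (u : R) : I u ->
  is_derive_on I (fun s => area2 m (gamma s) (dgamma s)) u
    (2 * m ^ 2 * (Re (dgamma u) * Re (ddgamma u) + Im (dgamma u) * Im (ddgamma u))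
     + 2 * (Re (dgamma u) * Re (gamma u) + Im (dgamma u) * Im (gamma u))
       * (Re (ddgamma u) * Re (gamma u) + Re (dgamma u) ^ 2
          + Im (ddgamma u) * Im (gamma u) + Im (dgamma u) ^ 2)).
Proof.
  intros Iu. destruct (gamma_derivatives u Iu) as (Hx & Hy & Hp & Hq).
  extend Hx. extend Hy. extend Hp. extend Hq.
  apply (is_derive_on_ext I (fun s =>
    m ^ 2 * (fe1 s ^ 2 + fe2 s ^ 2) + (fe1 s * fe s + fe2 s * fe0 s) ^ 2)); auto.
  { intros s Is. unfold area2. now rewrite Ee, Ee0, Ee1, Ee2. }
  apply is_derive_is_derive_on; auto.
  rewrite <- (Ee u), <- (Ee0 u), <- (Ee1 u), <- (Ee2 u) by assumption.
  auto_derive.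
  - repeat split; eexists; eassumption.
  - rewrite Dfe, Dfe0, Dfe1, Dfe2. rewrite <- (Ee1 u), <- (Ee2 u) by assumption. ring.
Qed.

Lemma twist_derivative (u : R) : I u ->
  is_derive_on I (fun s => twist (gamma s) (dgamma s)) u
    (Im (ddgamma u) * Re (gamma u) - Re (ddgamma u) * Im (gamma u)).
Proof.
  intros Iu. destruct (gamma_derivatives u Iu) as (Hx & Hy & Hp & Hq).
  extend Hx. extend Hy. extend Hp. extend Hq.
  apply (is_derive_on_ext I (fun s => fe2 s * fe s - fe1 s * fe0 s)); auto.
  { intros s Is. unfold twist. now rewrite Ee, Ee0, Ee1, Ee2. }
  apply is_derive_is_derive_on; auto.
  auto_derive.
  - repeat split; eexists; eassumption.
  - rewrite Dfe, Dfe0, Dfe1, Dfe2, Ee, Ee0, Ee1, Ee2 by assumption. ring.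
Qed.

Lemma radial_derivative (u : R) : I u ->
  is_derive_on I
    (fun s => Re (dgamma s) * Re (gamma s) + Im (dgamma s) * Im (gamma s)) u
    (Re (ddgamma u) * Re (gamma u) + Re (dgamma u) ^ 2
     + Im (ddgamma u) * Im (gamma u) + Im (dgamma u) ^ 2).
Proof.
  intros Iu. destruct (gamma_derivatives u Iu) as (Hx & Hy & Hp & Hq).
  extend Hx. extend Hy. extend Hp. extend Hq.
  apply (is_derive_on_ext I (fun s => fe1 s * fe s + fe2 s * fe0 s)); auto.
  { intros s Is. now rewrite Ee, Ee0, Ee1, Ee2. }
  apply is_derive_is_derive_on; auto.
  auto_derive.
  - repeat split; eexists; eassumption.
  - rewrite Dfe, Dfe0, Dfe1, Dfe2, Ee, Ee0, Ee1, Ee2 by assumption. ring.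
Qed.

Lemma square_norm_derivative (u : R) : I u ->
  is_derive_on I (fun s => Re (gamma s) ^ 2 + Im (gamma s) ^ 2) u
    (2 * (Re (dgamma u) * Re (gamma u) + Im (dgamma u) * Im (gamma u))).
Proof.
  intros Iu. destruct (gamma_derivatives u Iu) as (Hx & Hy & _).
  extend Hx. extend Hy.
  apply (is_derive_on_ext I (fun s => fe s ^ 2 + fe0 s ^ 2)); auto.
  { intros s Is. now rewrite Ee, Ee0. }
  apply is_derive_is_derive_on; auto.
  auto_derive.
  - repeat split; eexists; eassumption.
  - rewrite Dfe, Dfe0, Ee, Ee0 by assumption. ring.
Qed.

(** * The second fundamental form *)

Lemma normal_partial_u (u v : R) : I u ->
  let z := gamma u in let dz := dgamma u in let ddz := ddgamma u in
  exists k, partial_u I (unit_normal I (twizzler gamma m)) u v =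
  (k * (cos v * (m * Im dz) + sin v * (m * Re dz))
   + w u * (m * cos v * Im ddz + m * sin v * Re ddz),
   k * (sin v * (m * Im dz) + - cos v * (m * Re dz))
   + w u * (m * sin v * Im ddz + - m * cos v * Re ddz),
   k * (Re dz * Re z + Im dz * Im z)
   + w u * (Re ddz * Re z + Re dz ^ 2 + Im ddz * Im z + Im dz ^ 2)).
Proof.
  intros Iu z dz ddz.
  pose proof (is_derive_on_inv_sqrt I _ u _ Iu (gamma_area2_pos u Iu) (area2_derivative u Iu))
    as Hw.
  (* [k] is the derivative of [w]. Its value can stay hidden, because it multiplies a normal vector
     and so drops out of inner products with tangent vectors. *)
  match type of Hw with is_derive_on _ _ _ ?d => set (k := d) in Hw end. exists k.
  destruct (gamma_derivatives u Iu) as (Hx & Hy & Hp & Hq).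
  apply Derive_on_unique; [now apply domain_limit_point|].
  apply (is_derive_on_ext I (fun s =>
    (w s * (m * cos v * Im (dgamma s) + m * sin v * Re (dgamma s)),
     w s * (m * sin v * Im (dgamma s) + - m * cos v * Re (dgamma s)),
     w s * (Re (dgamma s) * Re (gamma s) + Im (dgamma s) * Im (gamma s))))); auto.
  { intros s Is. rewrite twizzler_unit_normal;
      [|now apply domain_limit_point|assumption|now apply gamma_derivable].
    fold dgamma. fold (w s). apply triple_eq; ring. }
  apply is_derive_on_triple.
  - replace (cos v * (m * Im dz) + sin v * (m * Re dz)) with
      (m * cos v * Im (dgamma u) + m * sin v * Re (dgamma u)) by (unfold dz; ring).
    apply (is_derive_on_mult I w
      (fun s => m * cos v * Im (dgamma s) + m * sin v * Re (dgamma s)) u k); auto.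
    now apply is_derive_on_combination.
  - replace (sin v * (m * Im dz) + - cos v * (m * Re dz)) with
      (m * sin v * Im (dgamma u) + - m * cos v * Re (dgamma u)) by (unfold dz; ring).
    apply (is_derive_on_mult I w
      (fun s => m * sin v * Im (dgamma s) + - m * cos v * Re (dgamma s)) u k); auto.
    now apply is_derive_on_combination.
  - apply (is_derive_on_mult I w
      (fun s => Re (dgamma s) * Re (gamma s) + Im (dgamma s) * Im (gamma s)) u k); auto.
    now apply radial_derivative.
Qed.

Lemma normal_partial_v (u v : R) : I u ->
  partial_v (unit_normal I (twizzler gamma m)) u v =
  (w u * (- sin v * (m * Im (dgamma u)) + cos v * (m * Re (dgamma u))),
   w u * (cos v * (m * Im (dgamma u)) + sin v * (m * Re (dgamma u))), 0).
Proof.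
  intros Iu. apply Derive_on_unique; [apply limit_point_full|].
  apply (is_derive_on_ext _ (fun t =>
    (w u * (cos t * (m * Im (dgamma u)) + sin t * (m * Re (dgamma u))),
     w u * (sin t * (m * Im (dgamma u)) + - cos t * (m * Re (dgamma u))),
     w u * (Re (dgamma u) * Re (gamma u) + Im (dgamma u) * Im (gamma u))))); auto.
  - intros t _. symmetry.
    apply twizzler_unit_normal; [now apply domain_limit_point|assumption|now apply gamma_derivable].
  - apply is_derive_on_triple; apply is_derive_is_derive_on; auto; auto_derive; auto; ring.
Qed.

(** The unknown [k] from [normal_partial_u] cancels by orthogonality, and [v] cancels by the
    Pythagorean identity. *)
Lemma shape_operator_entries (u v : R) : I u ->
  let z := gamma u in let dz := dgamma u in let ddz := ddgamma u in
  let Tu := partial_u I (twizzler gamma m) u v in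
  let Tv := partial_v (twizzler gamma m) u v in
  let Nu := partial_u I (unit_normal I (twizzler gamma m)) u v in
  let Nv := partial_v (unit_normal I (twizzler gamma m)) u v in
  dot Nu Tu = m * (Re dz * Im ddz - Im dz * Re ddz) * w u /\
  dot Nu Tv = m * (Re dz ^ 2 + Im dz ^ 2) * w u /\
  dot Nv Tu = m * (Re dz ^ 2 + Im dz ^ 2) * w u /\
  dot Nv Tv = m * twist z dz * w u.
Proof.
  intros Iu z dz ddz Tu Tv Nu Nv. unfold Tu, Tv, Nu, Nv.
  destruct (normal_partial_u u v Iu) as [k ->].
  rewrite normal_partial_v, twizzler_partial_u, twizzler_partial_v by
    (auto using domain_limit_point, gamma_derivable).
  fold z dz ddz. generalize (w u); intros wu.
  change (Derive_on I gamma u) with dz. unfold twist.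
  pose proof (sin2_cos2_pow v) as S.
  unfold dot, c1, c2, c3. cbn [fst snd].
  repeat split; ring [S].
Qed.

(** * Mean curvature, flux and the scalar form of the conservation law *)

Let h u := mean_curvature m (gamma u) (dgamma u) (ddgamma u).
Let radial u := Re (dgamma u) * Re (gamma u) + Im (dgamma u) * Im (gamma u).
Let norm2 u := Re (gamma u) ^ 2 + Im (gamma u) ^ 2.
Let flux u := m * (twist (gamma u) (dgamma u) * w u).

(** [frame_trace] gives the same value in every orthonormal frame, and the Gram-Schmidt frame shows
    that the value is attained. *)
Lemma is_mean_curvature_iff (u v k : R) : I u ->
  is_mean_curvature I (twizzler gamma m) u v k <-> k = h u.
Proof.
  intros Iu.
  destruct (twizzler_metric I gamma m u v (domain_limit_point u Iu) Iu (gamma_derivable u Iu))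
    as (HE & HF & HG).
  destruct (shape_operator_entries u v Iu) as (Hp & Hq & Hr & Hs).
  pose proof (gamma_area2_pos u Iu) as Hpos.
  assert (dz_pos : 0 < Re (dgamma u) ^ 2 + Im (dgamma u) ^ 2).
  (* For unit pitch and [z = 0], [area2] reduces to the squared length of [dgamma u]. *)
  { pose proof (area2_pos 1 0%C (dgamma u) Rlt_0_1 (gamma_immersed u Iu)) as K.
    unfold area2 in K. cbn [Re Im fst snd] in K. unfold RtoC, Re, Im in *. cbn [fst snd] in K.
    ring_simplify in K. lra. }
  fold dgamma in HE, HF, HG.
  set (z := gamma u) in *. set (dz := dgamma u) in *. set (ddz := ddgamma u) in *.
  set (E := Re dz ^ 2 + Im dz ^ 2) in *. set (F := twist z dz) in *.
  set (G := Re z ^ 2 + Im z ^ 2 + m ^ 2) in *.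
  assert (EGF : E * G - F ^ 2 = area2 m z dz).
  { unfold E, F, G, twist, area2. ring. }
  (* The right side of [frame_trace], evaluated at the entries of the second fundamental form, is
     the closed formula. *)
  assert (Hh : (G * (m * (Re dz * Im ddz - Im dz * Re ddz) * w u)
                - F * (m * E * w u + m * E * w u) + E * (m * F * w u))
               / (E * G - F ^ 2) = h u).
  { rewrite EGF. unfold h, mean_curvature, w. fold z dz ddz.
    change (twist z dz) with F. fold G E.
    pose proof (sqrt_lt_R0 _ Hpos) as Hs0.
    pose proof (sqrt_sqrt _ (Rlt_le _ _ Hpos)) as Ha. fold z dz in Ha, Hs0.
    set (r := sqrt (area2 m z dz)) in *. rewrite <- Ha. field. lra. }
  assert (D : forall a b c d,
    dot (D_normal I (twizzler gamma m) u v a b) (tangent I (twizzler gamma m) u v c d) =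
    a * c * (m * (Re dz * Im ddz - Im dz * Re ddz) * w u) + a * d * (m * E * w u)
    + b * c * (m * E * w u) + b * d * (m * F * w u)).
  { intros a b c d. unfold D_normal, tangent.
    rewrite dot_combination, Hp, Hq, Hr, Hs. reflexivity. }
  assert (M : forall a b c d,
    dot (tangent I (twizzler gamma m) u v a b) (tangent I (twizzler gamma m) u v c d) =
    a * c * E + (a * d + b * c) * F + b * d * G).
  { intros a b c d. unfold tangent. rewrite dot_combination, HE, HF, HG.
    replace (dot (partial_v (twizzler gamma m) u v) (partial_u I (twizzler gamma m) u v))
      with F; [ring|]. rewrite <- HF. unfold dot. ring. }
  assert (T : forall a1 b1 a2 b2,
    a1 ^ 2 * E + 2 * a1 * b1 * F + b1 ^ 2 * G = 1 ->
    a2 ^ 2 * E + 2 * a2 * b2 * F + b2 ^ 2 * G = 1 ->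
    a1 * a2 * E + (a1 * b2 + b1 * a2) * F + b1 * b2 * G = 0 ->
    dot (D_normal I (twizzler gamma m) u v a1 b1) (tangent I (twizzler gamma m) u v a1 b1)
    + dot (D_normal I (twizzler gamma m) u v a2 b2) (tangent I (twizzler gamma m) u v a2 b2)
    = h u).
  { intros a1 b1 a2 b2 H1 H2 H3. rewrite !D, <- Hh.
    rewrite <- (frame_trace a1 b1 a2 b2) by (auto; lra). ring. }
  split.
  - intros (a1 & b1 & a2 & b2 & (O1 & O2 & O3) & ->).
    rewrite M in O1, O2, O3. apply T; lra.
  - intros ->.
    destruct (orthonormal_frame_exists E F G) as (a1 & b1 & a2 & b2 & H1 & H2 & H3); [lra..|].
    exists a1, b1, a2, b2. split; [|symmetry; now apply T].
    unfold orthonormal. rewrite !M. lra.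
Qed.

(** With [g] the squared area density, the quotient rule gives the numerator
    [twist' g - twist g' / 2]. Both its part with [m ^ 2] and its part without have [radial] as a
    factor. *)
Lemma flux_derivative (u : R) : I u -> is_derive_on I flux u (h u * radial u).
Proof.
  intros Iu. unfold flux.
  pose proof (gamma_area2_pos u Iu) as Hpos.
  pose proof (is_derive_on_inv_sqrt I _ u _ Iu Hpos (area2_derivative u Iu)) as Hw.
  pose proof (is_derive_on_mult I _ _ u _ _ Iu (twist_derivative u Iu) Hw) as H.
  assert (Hm : is_derive_on I (fun _ => m) u 0).
  { apply is_derive_is_derive_on; auto. apply (is_derive_const (V := R_NormedModule) m). }
  pose proof (is_derive_on_mult I _ _ u _ _ Iu Hm H) as H'. cbv beta in H'.
  match type of H' with is_derive_on _ _ _ ?d => replace (h u * radial u) with d; [exact H'|] end.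
  clear H' H Hw Hm.
  unfold h, radial, mean_curvature.
  pose proof (sqrt_lt_R0 _ Hpos) as Hs. pose proof (sqrt_sqrt _ (Rlt_le _ _ Hpos)) as Ha.
  set (r := sqrt (area2 m (gamma u) (dgamma u))) in *.
  (* Everything is put over [r ^ 3], leaving a polynomial identity. *)
  replace (/ r) with (area2 m (gamma u) (dgamma u) / r ^ 3) by (rewrite <- Ha; field; lra).
  unfold area2, twist. field. lra.
Qed.

(** When [radial] vanishes, the area density is [m |dgamma u|]. The resulting value is
    [1 / |gamma u|] up to sign, as on a circular cylinder of that radius. *)
Lemma mean_curvature_radial_critical (u : R) : I u -> radial u = 0 ->
  Re (ddgamma u) * Re (gamma u) + Re (dgamma u) ^ 2
     + Im (ddgamma u) * Im (gamma u) + Im (dgamma u) ^ 2 = 0 ->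
  norm2 u <> 0 /\ h u = flux u / norm2 u.
Proof.
  intros Iu HP HdP.
  pose proof (gamma_area2_pos u Iu) as Hpos.
  apply radial_critical_identity; auto.
  - now apply sqrt_lt_R0.
  - rewrite sqrt_sqrt by lra. unfold area2. unfold radial in HP. rewrite HP. ring.
Qed.

(** The second derivative of the curve is only continuous, so the argument uses limits instead of
    differentiability of [h]. *)
Lemma mean_curvature_continuous (u : R) : I u ->
  filterlim h (within I (locally u)) (locally (h u)).
Proof.
  intros Iu.
  assert (D : forall (f : R -> R) l, is_derive_on I f u l ->
    filterlim f (within I (locally u)) (locally (f u))).
  { intros f l Hf.
    apply (filterdiff_continuous_aux (U := R_NormedModule) (V := R_NormedModule) f).
    - now eexists; apply Hf.
    - apply within_is_filter_lim. }
  assert (Add : forall f g : R -> R,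
    filterlim f (within I (locally u)) (locally (f u)) ->
    filterlim g (within I (locally u)) (locally (g u)) ->
    filterlim (fun s => f s + g s) (within I (locally u)) (locally (f u + g u))).
  { intros f g Hf Hg. apply (filterlim_comp_2 f g Rplus Hf Hg).
    apply (filterlim_plus (V := R_NormedModule) (f u) (g u)). }
  assert (Mul : forall f g : R -> R,
    filterlim f (within I (locally u)) (locally (f u)) ->
    filterlim g (within I (locally u)) (locally (g u)) ->
    filterlim (fun s => f s * g s) (within I (locally u)) (locally (f u * g u))).
  { intros f g Hf Hg. apply (filterlim_comp_2 f g Rmult Hf Hg).
    apply (filterlim_mult (K := R_AbsRing) (f u) (g u)). }
  assert (Cst : forall c : R, filterlim (fun _ => c) (within I (locally u)) (locally c)).
  { intros c. apply filterlim_const. }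
  destruct (gamma_derivatives u Iu) as (Hx & Hy & Hp & Hq).
  apply D in Hx, Hy, Hp, Hq.
  pose proof (D _ _ (twist_derivative u Iu)) as Ht.
  pose proof (D _ _ (is_derive_on_inv_sqrt I _ u _ Iu (gamma_area2_pos u Iu)
    (area2_derivative u Iu))) as Hw.
  assert (Ha : filterlim (fun s => Re (ddgamma s)) (within I (locally u))
                 (locally (Re (ddgamma u)))).
  { destruct gamma_C2 as (_ & _ & H3).
    apply (filterlim_comp _ _ _ ddgamma Re _ _ _ (H3 u Iu)).
    apply (continuous_fst (U := R_UniformSpace) (V := R_UniformSpace)). }
  assert (Hb : filterlim (fun s => Im (ddgamma s)) (within I (locally u))
                 (locally (Im (ddgamma u)))).
  { destruct gamma_C2 as (_ & _ & H3).
    apply (filterlim_comp _ _ _ ddgamma Im _ _ _ (H3 u Iu)).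
    apply (continuous_snd (U := R_UniformSpace) (V := R_UniformSpace)). }
  (* [h] is rewritten with sums, products and constants only, so [Add], [Mul] and [Cst] suffice. *)
  set (k := fun s => m * ((Re (gamma s) * Re (gamma s) + Im (gamma s) * Im (gamma s) + m * m)
      * (Re (dgamma s) * Im (ddgamma s) + (-1) * (Im (dgamma s) * Re (ddgamma s)))
      + (-1) * (twist (gamma s) (dgamma s)
         * (Re (dgamma s) * Re (dgamma s) + Im (dgamma s) * Im (dgamma s))))
    * (w s * (w s * w s))).
  assert (E : forall s, I s -> k s = h s).
  { intros s Is. unfold k, h, mean_curvature, w.
    pose proof (sqrt_lt_R0 _ (gamma_area2_pos s Is)). field. lra. }
  rewrite <- E by assumption.
  apply (filterlim_within_ext I k h E).
  unfold k. repeat first [exact Ht | exact Hw | apply Mul | apply Add]; auto.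
Qed.

Lemma squared_modulus (u : R) : Cmod (gamma u) ^ 2 = norm2 u.
Proof.
  unfold Cmod. rewrite <- Rsqr_pow2, Rsqr_sqrt; [reflexivity|]. nra.
Qed.

Lemma constant_mean_curvature_iff (k : R) :
  has_constant_mean_curvature I (twizzler gamma m) k <-> forall u, I u -> h u = k.
Proof.
  split.
  - intros H u Iu. symmetry. apply (is_mean_curvature_iff u 0); auto.
  - intros H u v Iu. apply is_mean_curvature_iff; auto. symmetry; auto.
Qed.

(** The combination is written as [a * f + b * g] to fit [is_derive_on_combination]. *)
Lemma conservation_law_iff (H c : R) :
  conservation_law I gamma m H c <-> forall u, I u -> 2 * PI * flux u + - (H * PI) * norm2 u = c.
Proof.
  assert (E : forall u v, I u ->
    2 * PI / area_density I (twizzler gamma m) u v * m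
      * dot (plane (Derive_on I gamma u)) (plane (Cmult Ci (gamma u)))
    - H * PI * Cmod (gamma u) ^ 2 = 2 * PI * flux u + - (H * PI) * norm2 u).
  { intros u v Iu.
    rewrite twizzler_area_density by (auto using domain_limit_point, gamma_derivable).
    rewrite squared_modulus. unfold flux, w, dgamma, twist, dot, plane, Ci, Cmult, c1, c2, c3.
    unfold Re, Im. cbn [fst snd].
    pose proof (sqrt_lt_R0 _ (gamma_area2_pos u Iu)) as Hs. unfold dgamma in Hs. field. lra. }
  split.
  - intros L u Iu. rewrite (L u 0 Iu). symmetry. now apply E.
  - intros L u v Iu. rewrite E by assumption. symmetry. auto.
Qed.

(** * Where the derivative of the conserved quantity vanishes *)

Lemma conserved_quantity_derivative (H u : R) : I u ->
  is_derive_on I (fun s => 2 * PI * flux s + - (H * PI) * norm2 s) u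
    (2 * PI * ((h u - H) * radial u)).
Proof.
  intros Iu.
  replace (2 * PI * ((h u - H) * radial u)) with
    (2 * PI * (h u * radial u) + - (H * PI) * (2 * radial u)) by ring.
  apply is_derive_on_combination; auto.
  - now apply flux_derivative.
  - now apply square_norm_derivative.
Qed.

Lemma locally_mean_curvature_constant (u0 H : R) :
  (forall s, I s -> (h s - H) * radial s = 0) -> I u0 -> h u0 <> H ->
  within I (locally u0) (fun s => h s = h u0).
Proof.
  intros HP Iu0 Hne.
  destruct (mean_curvature_continuous u0 Iu0 (fun y => y <> H)) as [d Hd].
  { apply (open_neq H). exact Hne. }
  (* On [J] the factor [h - H] has no zero, so [radial] vanishes. That [J] is an interval permits
     the constancy argument inside it. *)
  set (J := fun s => I s /\ ball u0 d s).
  assert (JI : forall s, J s -> I s) by (now intros s []).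
  assert (JP : forall s, J s -> radial s = 0).
  { intros s [Is Bs]. specialize (Hd s Bs Is). cbv beta in Hd.
    destruct (Rmult_integral _ _ (HP s Is)); [lra|auto]. }
  assert (J_interval : is_interval J).
  { intros a b s [Ia Ba] [Ib Bb] Hs. split; [now apply (I_interval a b)|].
    apply Rabs_lt_between'. apply Rabs_lt_between' in Ba, Bb. lra. }
  assert (J0 : J u0) by (split; [assumption|apply ball_center]).
  assert (Jh : forall s, J s -> norm2 s <> 0 /\ h s = flux s / norm2 s).
  { intros s Js. apply mean_curvature_radial_critical; auto.
    (* The derivative of [radial] has two values: its formula, and 0 because [radial] vanishes near
       [s]. *)
    apply (is_derive_on_unique I radial s); auto using domain_limit_point.
    - apply radial_derivative; auto.
    - apply is_derive_on_locally_const; auto.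
      destruct Js as [Is Bs].
      apply Rabs_lt_between' in Bs.
      pose proof (open_and _ _ (open_gt (u0 - d)) (open_lt (u0 + d)) s Bs) as O.
      unfold within. revert O. apply filter_imp. intros t Bt It. rewrite !JP; auto.
      + split; auto. now apply Rabs_lt_between'.
      + split; auto. now apply Rabs_lt_between'. }
  exists d. intros s Bs Is. assert (Js : J s) by now split.
  (* Numerator and denominator of [flux / norm2] are constant on [J], their derivatives being
     multiples of [radial]. *)
  rewrite (proj2 (Jh s Js)), (proj2 (Jh u0 J0)). apply (f_equal2 Rdiv).
  - apply (is_derive_on_zero_const J); auto. intros t Jt.
    apply (is_derive_on_subset I J); auto.
    replace 0 with (h t * radial t) by (rewrite JP; auto; ring).
    apply flux_derivative; auto.
  - apply (is_derive_on_zero_const J); auto. intros t Jt.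
    apply (is_derive_on_subset I J); auto.
    replace 0 with (2 * radial t) by (rewrite JP; auto; ring).
    apply square_norm_derivative; auto.
Qed.

Lemma mean_curvature_dichotomy (H : R) :
  (forall s, I s -> (h s - H) * radial s = 0) ->
  (forall u, I u -> h u = H) \/
  (forall u, I u -> radial u = 0) /\ exists k, forall u, I u -> h u = k.
Proof.
  intros HP.
  destruct (classic (exists u0, I u0 /\ h u0 <> H)) as [(u0 & Iu0 & Hne)|Hn].
  2: { left. intros u Iu. apply NNPP. intros Hu. apply Hn. now exists u. }
  assert (Hc : forall u, I u -> h u = h u0).
  (* The indicator of the level set of [h] through [u0] is locally constant, hence has zero
     derivative and is constant on [I]. *)
  { set (k := fun u => if Req_EM_T (h u) (h u0) then 1 else 0).
    intros u Iu.
    assert (E : k u = k u0).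
    { apply (is_derive_on_zero_const I); auto. intros s Is.
      apply is_derive_on_locally_const; auto.
      (* On the level set [h] still avoids [H], so [locally_mean_curvature_constant] applies; off
         it, continuity of [h] keeps nearby points off it. *)
      destruct (Req_dec (h s) (h u0)) as [Es|Es].
      - assert (Hs : h s <> H) by congruence.
        pose proof (locally_mean_curvature_constant s H HP Is Hs) as L.
        revert L. apply filter_imp. intros t Ht. unfold k. now rewrite Ht.
      - pose proof (mean_curvature_continuous s Is _ (open_neq (h u0) (h s) Es)) as L.
        revert L. unfold filtermap, within. apply filter_imp.
        intros t Ht It. specialize (Ht It). unfold k.
        destruct (Req_EM_T (h t) (h u0)), (Req_EM_T (h s) (h u0)); easy. }
    unfold k in E.
    destruct (Req_EM_T (h u) (h u0)), (Req_EM_T (h u0) (h u0)); auto; lra. }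
  right. split; [|now exists (h u0)].
  intros u Iu. specialize (HP u Iu). rewrite Hc in HP by assumption.
  destruct (Rmult_integral _ _ HP); [lra|auto].
Qed.

(** * From the conservation law to constant mean curvature, and back *)

Lemma conservation_law_critical (H c : R) :
  conservation_law I gamma m H c -> forall u, I u -> (h u - H) * radial u = 0.
Proof.
  intros L u Iu. rewrite conservation_law_iff in L.
  assert (E : 2 * PI * ((h u - H) * radial u) = 0).
  { apply (is_derive_on_unique I (fun s => 2 * PI * flux s + - (H * PI) * norm2 s) u);
      [now apply domain_limit_point|now apply conserved_quantity_derivative|].
    apply is_derive_on_locally_const; auto.
    apply (filter_forall (F := locally u)). intros s Is. now rewrite !L. }
  pose proof PI_RGT_0. apply Rmult_integral in E as [E|E]; [lra|exact E].
Qed.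

Lemma radially_critical_cylinder : (forall u, I u -> radial u = 0) -> is_cylinder I gamma.
Proof.
  intros HP. destruct I_nondegenerate as (a & _ & Ia & _).
  exists (Cmod (gamma a)). intros u Iu.
  assert (E : norm2 u = norm2 a).
  { apply (is_derive_on_zero_const I); auto. intros s Is.
    replace 0 with (2 * radial s) by (rewrite HP; auto; ring). now apply square_norm_derivative. }
  rewrite <- !squared_modulus in E. apply Rsqr_inj; try apply Cmod_ge_0.
  now rewrite !Rsqr_pow2.
Qed.

Lemma constant_mean_curvature_conservation_law :
  (exists k, has_constant_mean_curvature I (twizzler gamma m) k) <->
  (exists H c, conservation_law I gamma m H c).
Proof.
  split.
  - intros [k Hk]. rewrite constant_mean_curvature_iff in Hk.
    destruct I_nondegenerate as (a & _ & Ia & _).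
    (* With [H = k] the derivative of the conserved quantity vanishes, and [c] is its value at a
       reference point [a]. *)
    exists k, (2 * PI * flux a + - (k * PI) * norm2 a).
    apply conservation_law_iff. intros u Iu.
    apply (is_derive_on_zero_const I (fun s => 2 * PI * flux s + - (k * PI) * norm2 s)); auto.
    intros s Is. replace 0 with (2 * PI * ((h s - k) * radial s)).
    + now apply conserved_quantity_derivative.
    + rewrite Hk by assumption. ring.
  - intros (H & c & L).
    (* On a cylinder the conserved quantity is constant for every [H], so there the curvature is the
       [k] of the dichotomy and may differ from [H]. *)
    destruct (mean_curvature_dichotomy H (conservation_law_critical H c L)) as [E|[_ [k E]]];
      [exists H|exists k]; now apply constant_mean_curvature_iff.
Qed.

(** The alternative in which [radial] vanishes throughout makes the surface a cylinder, leaving only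
    [h = H]. *)
Lemma conservation_law_mean_curvature (H c : R) :
  ~ is_cylinder I gamma -> conservation_law I gamma m H c ->
  has_constant_mean_curvature I (twizzler gamma m) H.
Proof.
  intros Hn L.
  destruct (mean_curvature_dichotomy H (conservation_law_critical H c L)) as [E|[E _]].
  - now apply constant_mean_curvature_iff.
  - elim Hn. now apply radially_critical_cylinder.
Qed.

End Twizzler.

Theorem theorem3p3 (I : R -> Prop) (gamma : R -> C) (m : R)
  (I_interval : is_interval I) (I_nondegenerate : nondegenerate I)
  (gamma_C2 : C2_on I gamma) (gamma_immersed : immersed_on I gamma)
  (m_pos : 0 < m) :
  ((exists h, has_constant_mean_curvature I (twizzler gamma m) h) <->
   (exists H c, conservation_law I gamma m H c)) /\
  (~ is_cylinder I gamma ->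
   forall H c, conservation_law I gamma m H c ->
   has_constant_mean_curvature I (twizzler gamma m) H).
Proof.
  split.
  - now apply constant_mean_curvature_conservation_law.
  - intros Hn H c. now apply conservation_law_mean_curvature.
Qed.
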